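(* Let $R_n$ be any bounded relaxation of $\mathrm{QAP}_n$ (a polytope in $\mathbb{R}^{n^2\times n^2}$ containing $\mathrm{QAP}_n$) such that all inequalities $$\sum_{r=1}^{m}Y_{i_rj_r,i_rj_r}-\sum_{1\leqslant r<s\leqslant m}Y_{i_rj_r,i_sj_s}\leqslant 1,$$ with $m,n\geqslant7$, $i_1,\dots,i_m\in[n]$ distinct and $j_1,\dots,j_m\in[n]$ distinct, are valid for $R_n$. Then $\mathrm{xc}(R_n)\geqslant 2^{\Omega(n)}$.
   Context: $P_\sigma$ is the $n\times n$ permutation matrix of $\sigma\in S_n$ ($P_\sigma(i,j)=1$ iff $\sigma(i)=j$). Matrices in $\mathbb{R}^{n^2\times n^2}$ have rows and columns indexed by pairs $(ij)$, $i,j\in[n]$; $Y_{ij,kl}$ is the entry in row $(ij)$, column $(kl)$. $P^{[2]}_\sigma(ij,kl)=P_\sigma(i,j)P_\sigma(k,l)$ and $\mathrm{QAP}_n=\mathrm{conv}\{P^{[2]}_\sigma:\sigma\in S_n\}$. A polytope $Q\subset\mathbb{R}^{d+r}$ is an extension of a polytope $P\subset\mathbb{R}^d$ if $P=\{x:\exists y,\ (x,y)\in Q\}$; the extension complexity $\mathrm{xc}(P)$ is the minimum number of facets of an extension of $P$. *)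

(* Defs.v *)
From HB Require Import structures.
From mathcomp Require Import all_boot all_order all_fingroup all_algebra.
From mathcomp Require Import boolp classical_sets functions cardinality.
From mathcomp Require Import reals exp.

Set Implicit Arguments.
Unset Strict Implicit.
Unset Printing Implicit Defensive.

Import Order.TTheory GRing.Theory Num.Theory.

Local Open Scope classical_set_scope.
Local Open Scope ring_scope.

Section Polytopes.
Variables (R : realType) (V : lmodType R).
Implicit Types P F G : set V.

Definition conv_hull (A : set V) : set V :=
  [set z | exists (k : nat) (x : 'I_k -> V) (w : 'I_k -> R),
    [/\ forall i, A (x i), forall i, 0 <= w i, \sum_i w i = 1
      & z = \sum_i w i *: x i]].

Definition polytope P : Prop := exists s : seq V, P = conv_hull [set` s].

Definition valid_ineq P (f : {scalar V}) (b : R) : Prop :=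
  forall x, P x -> f x <= b.

Definition face P F : Prop :=
  exists (f : {scalar V}) (b : R),
    valid_ineq P f b /\ F = [set x | P x /\ f x = b].

Definition proper_face P F : Prop := [/\ face P F, F !=set0 & F <> P].

(* A facet is an inclusion-maximal nonempty proper face. For polytopes of
   dimension at least 1 these are the faces of codimension 1; a single point
   has no facet. *)
Definition facet P F : Prop :=
  proper_face P F /\ forall G, proper_face P G -> F `<=` G -> G = F.

Definition has_nfacets P (k : nat) : Prop :=
  ([set F | facet P F] #= `I_k)%card.

End Polytopes.

Section ExtensionComplexity.
Variables (R : realType) (V : lmodType R).
Implicit Types P : set V.

Definition extension (r : nat) P (Q : set (V * 'rV[R]_r)%type) : Prop :=
  polytope Q /\ P = [set x | exists y, Q (x, y)].

Definition has_extension_of_size P (k : nat) : Prop :=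
  exists (r : nat) (Q : set (V * 'rV[R]_r)%type),
    extension P Q /\ has_nfacets Q k.

(* The minimum exists for every polytope P (take P itself, with r = 0);
   otherwise xc P defaults to 0. *)
Definition xc P : nat :=
  xget 0%N [set k | has_extension_of_size P k /\
    forall k', has_extension_of_size P k' -> (k <= k')%N].

End ExtensionComplexity.

Section QAP.
Variables (R : realType) (n : nat).

(* The pair (ij) is encoded as mxvec_index i j : 'I_(n * n). Note that
   perm_mx s i j = 1 iff s i = j. *)
Definition qap_entry (Y : 'M[R]_(n * n)) (i j k l : 'I_n) : R :=
  Y (mxvec_index i j) (mxvec_index k l).

Definition perm_mx2 (s : 'S_n) : 'M[R]_(n * n) :=
  \matrix_(a, b) (mxvec (perm_mx s) 0 a * mxvec (perm_mx s) 0 b).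

Lemma perm_mx2E (s : 'S_n) (i j k l : 'I_n) :
  qap_entry (perm_mx2 s) i j k l = perm_mx s i j * perm_mx s k l.
Proof. by rewrite /qap_entry mxE !mxvecE. Qed.

Definition QAP : set 'M[R]_(n * n) := conv_hull (range perm_mx2).

Definition qap_ineq (m : nat) (i j : 'I_m -> 'I_n) (Y : 'M[R]_(n * n)) : Prop :=
  \sum_(r < m) qap_entry Y (i r) (j r) (i r) (j r)
  - \sum_(r < m) \sum_(s < m | (r < s)%N) qap_entry Y (i r) (j r) (i s) (j s)
  <= 1.

End QAP.

Arguments QAP : clear implicits.

(* Main.v *)
(* Kaibel and Weltge's argument. For bit strings a, b of length k, pad a with
   seven dummy positions and take the QAP inequality with i = j enumerating
   the resulting set; let s_b be the involution of [n] fixing x and n - 1 - x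
   when bit x of b is set, and exchanging them otherwise. The slack of the
   inequality at s_b is 1 if a and b are disjoint and 0 if they meet once. In
   an extension Q of R_n, let G_a be the face cut out by the inequality and q_b
   a preimage of the matrix of s_b. Each facet F of Q gives the rectangle of
   pairs (a, b) with G_a inside F and q_b outside F: it contains no pair
   meeting once, and these rectangles cover all 3^k disjoint pairs because
   every face is an intersection of facets. A rectangle without pairs meeting
   once contains at most 2^k disjoint pairs, so Q has at least (3/2)^k facets,
   where k is about n / 2. *)

Require Import Defs.
From HB Require Import structures.
From mathcomp Require Import all_boot all_order all_fingroup all_algebra.
From mathcomp Require Import boolp classical_sets functions cardinality.
From mathcomp Require Import reals exp.
From mathcomp Require Import zify ring lra.

Set Implicit Arguments.
Unset Strict Implicit.
Unset Printing Implicit Defensive.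

Import Order.TTheory GRing.Theory Num.Theory.

(** * Rectangle covers of the disjoint pairs *)

Definition overlap (k : nat) (a b : bitseq) : nat :=
  \sum_(x < k) (nth false a x && nth false b x).

Lemma overlap_cons k x a y b :
  overlap k.+1 (x :: a) (y :: b) = (x && y) + overlap k a b.
Proof. by rewrite /overlap big_ord_recl. Qed.

(** The sum of [F] over the [3 ^ k] disjoint pairs of bit strings of length [k], split by their
    first bits so that inductions on [k] follow it. *)
Fixpoint disjoint_sum (k : nat) (F : bitseq -> bitseq -> nat) : nat :=
  if k is k'.+1 then
    disjoint_sum k' (fun a b => F (false :: a) (false :: b))
    + disjoint_sum k' (fun a b => F (true :: a) (false :: b))
    + disjoint_sum k' (fun a b => F (false :: a) (true :: b))
  else F [::] [::].

Lemma disjoint_sum_le k F G :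
  (forall a b, size a = k -> size b = k -> overlap k a b = 0 ->
     F a b <= G a b) ->
  disjoint_sum k F <= disjoint_sum k G.
Proof.
elim: k F G => [|k IH] F G leFG /=.
  by apply: leFG => //; rewrite /overlap big_ord0.
by rewrite !leq_add //; apply: IH => a b sa sb ab; apply: leFG;
  rewrite ?overlap_cons ?andbF //= ?sa ?sb.
Qed.

Lemma disjoint_sumD k F G :
  disjoint_sum k (fun a b => F a b + G a b)
  = disjoint_sum k F + disjoint_sum k G.
Proof. by elim: k F G => //= k IH F G; rewrite !IH; lia. Qed.

Lemma disjoint_sum1 k : disjoint_sum k (fun _ _ => 1) = 3 ^ k.
Proof. by elim: k => //= k ->; rewrite expnS; lia. Qed.

Lemma disjoint_sum_big k t (F : 'I_t -> bitseq -> bitseq -> nat) :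
  disjoint_sum k (fun a b => \sum_(c < t) F c a b)
  = \sum_(c < t) disjoint_sum k (F c).
Proof.
elim: k F => //= k IH F.
by rewrite !big_split /= !IH.
Qed.

Lemma disjoint_sum_rectangle k (X Y : pred bitseq) :
  (forall a b, size a = k -> size b = k -> X a -> Y b -> overlap k a b <> 1) ->
  disjoint_sum k (fun a b => X a && Y b) <= 2 ^ k.
Proof.
elim: k X Y => [|k IH] X Y no1 /=; first by case: (_ && _).
set X0 := fun a => X (false :: a); set X1 := fun a => X (true :: a).
set Y0 := fun b => Y (false :: b); set Y1 := fun b => Y (true :: b).
(* A disjoint pair has at most two of its three extensions in X * Y, and
   these are accounted for by two rectangles of lower dimension. *)
have le1 : disjoint_sum k (fun a b => (X0 a || X1 a) && Y0 b) <= 2 ^ k.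
  apply: IH => a b sa sb /orP[] Xa Yb ab;
  by apply: (no1 _ _ _ _ Xa Yb); rewrite ?overlap_cons ?ab /= ?sa ?sb.
have le2 : disjoint_sum k (fun a b => X0 a && (Y0 b || Y1 b)) <= 2 ^ k.
  apply: IH => a b sa sb Xa /orP[] Yb ab;
  by apply: (no1 _ _ _ _ Xa Yb); rewrite ?overlap_cons ?ab /= ?sa ?sb.
rewrite expnS mul2n -addnn; apply: leq_trans (leq_add le1 le2).
rewrite -!disjoint_sumD; apply: disjoint_sum_le => a b sa sb ab.
have : ~~ (X1 a && Y1 b).
  apply/negP => /andP[Xa Yb].
  by apply: (no1 _ _ _ _ Xa Yb); rewrite ?overlap_cons ?ab /= ?sa ?sb.
rewrite -/(X0 a) -/(X1 a) -/(Y0 b) -/(Y1 b).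
by case: (X0 a); case: (X1 a); case: (Y0 b); case: (Y1 b).
Qed.

(** Double counting: every disjoint pair lies in at least one of the [t] rectangles, and each
    rectangle holds at most [2 ^ k] of them. *)
Lemma rectangle_cover_bound k t (X Y : 'I_t -> pred bitseq) :
  (forall a b, size a = k -> size b = k -> overlap k a b = 0 ->
     exists c, X c a && Y c b) ->
  (forall c a b, size a = k -> size b = k -> X c a -> Y c b ->
     overlap k a b <> 1) ->
  3 ^ k <= t * 2 ^ k.
Proof.
move=> cover no1; rewrite -disjoint_sum1.
apply: (@leq_trans (disjoint_sum k (fun a b => \sum_(c < t) (X c a && Y c b)))).
  apply: disjoint_sum_le => a b sa sb ab.
  by have [c Xc] := cover a b sa sb ab; rewrite (bigD1 c) //= Xc.
rewrite disjoint_sum_big.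
have -> : t * 2 ^ k = \sum_(c < t) 2 ^ k by rewrite sum_nat_const card_ord.
by apply: leq_sum => c _; apply: disjoint_sum_rectangle => a b; apply: no1.
Qed.

Local Open Scope classical_set_scope.
Local Open Scope ring_scope.

(** * Facets and extensions of polytopes *)

Lemma scalar_exists (R : realType) (V : lmodType R) (f : V -> R) :
  scalar f -> exists g : {scalar V}, g =1 f.
Proof.
move=> lin_f.
pose g : {scalar V} := HB.pack f (GRing.isLinear.Build _ _ _ _ f lin_f).
by exists g.
Qed.

Lemma count_lt (T : eqType) (p q : pred T) (s : seq T) (u : T) :
  {in s, subpred p q} -> u \in s -> q u -> ~~ p u -> (count p s < count q s)%N.
Proof.
elim: s => //= v s IH pq; rewrite inE => us qu pu.
have pqs : {in s, subpred p q}.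
  by move=> w ws; apply: pq; rewrite inE ws orbT.
have le_v : (p v <= q v)%N.
  by case pv: (p v) => //; rewrite (pq v) // inE eqxx.
have [->|uv] := eqVneq v u.
  rewrite qu (negbTE pu) add0n add1n ltnS.
  rewrite -(@eq_in_count _ (predI p q)).
    by apply: sub_count => w /andP[].
  by move=> w ws /=; case pw: (p w) => //=; rewrite (pqs w).
rewrite eq_sym (negbTE uv) /= in us.
by have := IH pqs us qu pu; lia.
Qed.

Lemma exists_argmin (R : realType) (T : eqType) (p : pred T) (F : T -> R)
    (s : seq T) :
  has p s ->
  exists2 u, u \in s /\ p u & forall v, v \in s -> p v -> F u <= F v.
Proof.
elim: s => //= v s IH.
have [/IH[u [us pu] min_u] _|/hasPn ns] := boolP (has p s); last first.
  rewrite orbF => pv; exists v; first by rewrite mem_head.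
  by move=> w; rewrite inE => /orP[/eqP->//|/ns/negP].
have [pvF|pvF] := boolP (p v && (F v <= F u)).
  have /andP[pv vu] := pvF.
  exists v; first by rewrite mem_head.
  move=> w; rewrite inE => /orP[/eqP->//|ws pw].
  exact: le_trans vu (min_u _ ws pw).
exists u; first by rewrite inE us orbT.
move=> w; rewrite inE => /orP[/eqP->|]; last exact: min_u.
by move=> pv; move: pvF; rewrite pv /= -ltNge => /ltW.
Qed.

Section Facets.
Variables (R : realType) (V : lmodType R) (s : seq V).
Let P := conv_hull [set` s].
Implicit Types f g : {scalar V}.

Lemma mem_conv_hull v : v \in s -> P v.
Proof.
move=> vs; exists 1%N, (fun=> v), (fun=> 1).
by split; rewrite ?big_ord1 ?scale1r.
Qed.

Lemma valid_ineq_vertex f b v : valid_ineq P f b -> v \in s -> f v <= b.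
Proof. by move=> fb vs; apply: fb; apply: mem_conv_hull. Qed.

Lemma valid_ineq_vertices f b :
  (forall v, v \in s -> f v <= b) -> valid_ineq P f b.
Proof.
move=> fb _ [k [x [w [xs w0 w1 ->]]]].
rewrite linear_sum /= -[leRHS]mul1r -w1 mulr_suml.
by apply: ler_sum => i _; rewrite linearZ /= ler_wpM2l // fb // xs.
Qed.

(** The slack of a convex combination is the weighted sum of the slacks at its points, all
    nonnegative, so it vanishes only if every term does. *)
Lemma valid_ineq_eq k (x : 'I_k -> V) (w : 'I_k -> R) f b :
  valid_ineq P f b -> (forall i, x i \in s) -> (forall i, 0 <= w i) ->
  \sum_i w i = 1 ->
  f (\sum_i w i *: x i) = b <-> (forall i, w i != 0 -> f (x i) = b).
Proof.
move=> fb xs w0 w1.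
have slack : b - f (\sum_i w i *: x i) = \sum_i w i * (b - f (x i)).
  rewrite linear_sum /= -{1}[b]mul1r -w1 mulr_suml -sumrB.
  by apply: eq_bigr => i _; rewrite linearZ /= mulrBr.
have ge0 i : 0 <= w i * (b - f (x i)).
  by rewrite mulr_ge0 // subr_ge0; apply: fb; apply: mem_conv_hull.
split=> [fx i wi|fx].
  move: slack; rewrite fx subrr => /esym/eqP.
  rewrite psumr_eq0 // => /allP/(_ i (mem_index_enum _))/=.
  by rewrite mulf_eq0 (negbTE wi) /= subr_eq0 => /eqP.
apply/esym/eqP; rewrite -subr_eq0 slack big1 // => i _.
by have [->|/fx->] := eqVneq (w i) 0; rewrite ?mul0r ?subrr ?mulr0.
Qed.

Lemma face_sub_vertices f b g c x :
  valid_ineq P f b -> valid_ineq P g c ->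
  (forall v, v \in s -> f v = b -> g v = c) ->
  P x -> f x = b -> g x = c.
Proof.
move=> fb gc fg [k [y [w [ys w0 w1 ->]]]].
move/(valid_ineq_eq fb ys w0 w1) => fy.
by apply/(valid_ineq_eq gc ys w0 w1) => i /fy; apply: fg; apply: ys.
Qed.

(* Either {f = b} is already a facet, or it lies in a larger proper face
   {g = c}. If {g = c} avoids v, recurse on it; otherwise subtract from
   b - f the largest multiple of c - g that keeps it nonnegative, which
   enlarges the face without reaching v. *)
Lemma facet_avoiding_vertex f b v :
  valid_ineq P f b -> [set x | P x /\ f x = b] !=set0 -> v \in s -> f v < b ->
  exists F, [/\ facet P F, [set x | P x /\ f x = b] `<=` F & ~ F v].
Proof.
move=> + + vs.
(* Induction on the number of generators off the face: each enlargement lowers it, and [v] is never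
   absorbed. *)
have [m] := ubnP (count (fun u => f u < b) s).
elim: m f b => // m IH f b; rewrite ltnS => le_m fb fn0 fv.
set F := [set x | P x /\ f x = b].
have Pv := mem_conv_hull vs.
have pF : proper_face P F.
  split; [by exists f, b|by []|move=> FP].
  have : F v by rewrite FP.
  by case=> _ fvb; rewrite fvb ltxx in fv.
have [facF|nfacF] := pselect (facet P F).
  by exists F; split=> // -[_ fvb]; rewrite fvb ltxx in fv.
have [G [pG FG nGF]] : exists G, [/\ proper_face P G, F `<=` G & G <> F].
  apply: contrapT => nG; apply: nfacF; split=> // G pG FG.
  by apply: contrapT => nGF; apply: nG; exists G.
have [[g [c [gc defG]]] _ nGP] := pG.
have fg u : P u -> f u = b -> g u = c.
  by move=> Pu fu; have := FG u (conj Pu fu); rewrite defG => -[].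
have step f' b' :
    valid_ineq P f' b' -> (forall u, P u -> f u = b -> f' u = b') ->
    (exists2 u, u \in s & f u < b /\ f' u = b') -> f' v < b' ->
    exists F, [/\ facet P F, [set x | P x /\ f x = b] `<=` F & ~ F v].
  move=> fb' ff' [u us [fu f'u]] f'v.
  have sub : F `<=` [set x | P x /\ f' x = b'].
    by move=> x [Px fx]; split=> //; apply: ff'.
  have [||H [fH subH nH]] := IH f' b' _ fb' _ f'v.
  - apply: leq_trans le_m; apply: (@count_lt _ _ _ _ u) => //.
      move=> w ws /= f'w; rewrite lt_neqAle fb ?andbT; last exact: mem_conv_hull.
      apply/eqP => /(ff' _ (mem_conv_hull ws)) e.
      by rewrite e ltxx in f'w.
    by rewrite f'u ltxx.
  - by case: fn0 => x /sub; exists x.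
  - by exists H; split=> //; apply: subset_trans sub subH.
have [gv|gv] := ltP (g v) c.
  apply: (step g c) => //.
  apply: contrapT => nu; apply: nGF; rewrite defG.
  apply/seteqP; split=> x [Px gx]; split=> //; last exact: fg.
  apply: (face_sub_vertices gc fb _ Px gx) => w ws gw.
  apply/eqP; rewrite eq_le (valid_ineq_vertex fb ws) /= leNgt; apply/negP => fw.
  by apply: nu; exists w.
have {}gv : g v = c by apply/eqP; rewrite eq_le gv gc.
have hasg : has (fun u => g u < c) s.
  apply: contrapT => /negP/hasPn ng; apply: nGP; rewrite defG.
  apply/seteqP; split=> [x []//|x Px]; split=> //.
  (* The zero functional is tight everywhere, so [g = c] at all generators would spread to the whole
     of [P]. *)
  have g0c : valid_ineq P (\0 : {scalar V}) 0 by move=> y _ /=.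
  apply: (face_sub_vertices g0c gc) => // w ws _.
  by apply/eqP; rewrite eq_le (valid_ineq_vertex gc ws) /= leNgt ng.
(* The minimal ratio is the multiple to subtract; [u], where it is attained, is a generator that
   joins the face. *)
have [u [us gu] min_u] := exists_argmin (fun u => (b - f u) / (c - g u)) hasg.
set l := (b - f u) / (c - g u) in min_u.
have [h hE] : exists h : {scalar V}, h =1 fun x => f x - l * g x.
  by apply: scalar_exists => a x y; rewrite !linearP /=; ring.
have l0 : 0 <= l.
  rewrite divr_ge0 ?subr_ge0 ?(ltW gu) //; exact: fb (mem_conv_hull us).
apply: (step h (b - l * c)).
- apply: valid_ineq_vertices => w ws; rewrite hE.
  have := fb _ (mem_conv_hull ws); have := gc _ (mem_conv_hull ws).
  rewrite le_eqVlt => /orP[/eqP->|gw] fw; first by rewrite lerD2r.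
  have := min_u w ws gw; rewrite ler_pdivlMr ?subr_gt0 //; lra.
- by move=> w Pw fw; rewrite hE fw (fg w).
- exists u => //; split.
    rewrite lt_neqAle fb ?andbT; last exact: mem_conv_hull.
    by apply/eqP => /(fg _ (mem_conv_hull us)) e; rewrite e ltxx in gu.
  have e : l * (c - g u) = b - f u by rewrite divfK // subr_eq0 gt_eqF.
  rewrite hE; lra.
- by rewrite hE gv; lra.
Qed.

(** A point off the face puts weight on some generator off the face. A facet missing that generator
    misses the point too, since points of a face put weight only on generators of that face. *)
Lemma facet_avoiding f b q :
  valid_ineq P f b -> [set x | P x /\ f x = b] !=set0 -> P q -> f q <> b ->
  exists F, [/\ facet P F, [set x | P x /\ f x = b] `<=` F & ~ F q].
Proof.
move=> fb fn0 [k [y [w [ys w0 w1 ->]]]] fq.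
have [i wi fi] : exists2 i, w i != 0 & f (y i) < b.
  apply: contrapT => ni; apply: fq; apply/(valid_ineq_eq fb ys w0 w1) => i wi.
  apply/eqP; rewrite eq_le (valid_ineq_vertex fb (ys i)) /= leNgt.
  by apply/negP => fi; apply: ni; exists i.
have [F [facF sF nF]] := facet_avoiding_vertex fb fn0 (ys i) fi.
exists F; split=> // Fq; apply: nF.
have [[[g [c [gc defF]]] _ _] _] := facF.
move: Fq; rewrite defF => -[_ /(valid_ineq_eq gc ys w0 w1) gq].
by split; [apply/mem_conv_hull/ys|apply: gq].
Qed.

Lemma finite_facets : finite_set [set F | facet P F].
Proof.
(* A face is determined by the generators on it, so every facet is the image of one of the finitely
   many index sets [m]. *)
pose face_of (m : {set 'I_(size s)}) := [set x | P x /\ exists f b,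
  [/\ valid_ineq P f b,
      forall i : 'I_(size s), f (tnth (in_tuple s) i) = b <-> i \in m
    & f x = b]].
apply: (@sub_finite_set _ _ (face_of @` setT)); last first.
  apply: finite_image; exact: finite_finset.
move=> F [[[f [b [fb defF]]] _ _] _].
exists [set i | f (tnth (in_tuple s) i) == b]%SET => //.
rewrite defF; apply/seteqP; split=> x [Px fx]; split=> //; last first.
  by exists f, b; split=> // i; rewrite inE; split=> /eqP.
case: fx => g [c [gc gs gx]].
apply: (face_sub_vertices gc fb _ Px gx) => v vs gv.
have /tnthP[i vi] : v \in in_tuple s := vs.
by move: gv; rewrite vi => /gs; rewrite inE => /eqP.
Qed.

End Facets.

Section Extensions.
Variables (R : realType) (V : lmodType R).

Lemma polytope_has_extension (P : set V) :
  polytope P -> exists k, has_extension_of_size P k.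
Proof.
case=> s ->; pose s' := [seq (x, 0 : 'rV[R]_0) | x <- s].
have [k fin_k] := finite_facets s'.
exists k, 0%N, (conv_hull [set` s']); split=> //; split; first by exists s'.
apply/seteqP; split=> x.
  case=> m [y [w [ys w0 w1 ->]]]; exists 0.
  exists m, (fun i => (y i, 0)), w; split=> //.
    by move=> i; apply/mapP; exists (y i) => //; apply: ys.
  rewrite [RHS]surjective_pairing; congr (_, _); last by rewrite [RHS]thinmx0.
  by rewrite (raddf_sum fst).
case=> z [m [y [w [ys w0 w1 e]]]].
exists m, (fun i => (y i).1), w; split=> //.
  by move=> i; have /mapP[v vs ->] := ys i.
by rewrite -[x]/((x, z).1) e (raddf_sum fst).
Qed.

Lemma xcP (P : set V) : polytope P -> has_extension_of_size P (xc P).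
Proof.
move=> /polytope_has_extension[k0 k0P].
have ex : exists k, `[< has_extension_of_size P k >].
  by exists k0; apply/asboolP.
have [k /asboolP kP k_min] := ex_minnP ex.
rewrite /xc; set A := [set _ | _].
have : A (xget 0%N A).
  by apply: xgetPex; exists k; split=> // k' k'P; apply/k_min/asboolP.
by case.
Qed.

Lemma facets_enum (P : set V) k : has_nfacets P k ->
  exists phi : 'I_k -> set V, forall F, facet P F -> exists c, F = phi c.
Proof.
rewrite /has_nfacets => e.
have /pcard_surjP[g gs] : ([set F | facet P F] #<= `I_k)%card.
  by move: e; rewrite card_eq_le => /andP[].
exists (fun c => g c) => F /gs[i /= ik gi].
by exists (Ordinal ik).
Qed.

End Extensions.

(** * The inequalities at permutation matrices *)

Section QAPForm.
Variables (R : realType) (n m : nat) (i j : 'I_m -> 'I_n).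

Definition qap_form (Y : 'M[R]_(n * n)) : R :=
  \sum_(r < m) qap_entry Y (i r) (j r) (i r) (j r)
  - \sum_(r < m) \sum_(s < m | (r < s)%N) qap_entry Y (i r) (j r) (i s) (j s).

Lemma qap_form_scalar : scalar qap_form.
Proof.
move=> a Y Z; rewrite /qap_form /qap_entry mulrBr !mulr_sumr addrACA -opprD.
rewrite -!big_split /=; congr (_ - _); apply: eq_bigr => r _.
  by rewrite !mxE.
by rewrite mulr_sumr -big_split; apply: eq_bigr => s _; rewrite !mxE.
Qed.

Let agree (s : 'S_n) (r : 'I_m) : bool := s (i r) == j r.

Lemma qap_entry_perm (s : 'S_n) (r t : 'I_m) :
  qap_entry (perm_mx2 R s) (i r) (j r) (i t) (j t) = (agree s r && agree s t)%:R.
Proof. by rewrite perm_mx2E !mxE -mulnb natrM. Qed.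

(** With [p] agreements the form equals [p - p(p-1)/2]; the cases [p = 0] and [p = 1] give slack 1
    and 0. *)
Lemma qap_form_agree0 (s : 'S_n) :
  (\sum_(r < m) (s (i r) == j r) = 0)%N -> qap_form (perm_mx2 R s) = 0.
Proof.
move=> /eqP; rewrite sum_nat_eq0 => /forallP s0.
have {}s0 r : agree s r = false by have := s0 r; rewrite /= eqb0 => /negbTE.
rewrite /qap_form !big1 ?subrr // => r _; last by rewrite qap_entry_perm s0.
by rewrite big1 // => t _; rewrite qap_entry_perm s0.
Qed.

Lemma qap_form_agree1 (s : 'S_n) :
  (\sum_(r < m) (s (i r) == j r) = 1)%N -> qap_form (perm_mx2 R s) = 1.
Proof.
move=> /eqP/sum_nat_eq1[r0 [_ /eqP]]; rewrite eqb1 => sr0 sr.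
have {}sr r : agree s r = (r == r0).
  have [->//|/sr/(_ isT)/eqP] := eqVneq r r0.
  by rewrite eqb0 => /negbTE.
rewrite /qap_form (bigD1 r0) //= qap_entry_perm sr eqxx big1 => [|r rr0].
  rewrite big1 ?subr0 ?addr0 // => r _; rewrite big1 // => t rt.
  rewrite qap_entry_perm !sr; case: eqVneq => //= er; case: eqVneq => //= et.
  by rewrite er et ltnn in rt.
by rewrite qap_entry_perm sr (negbTE rr0).
Qed.

End QAPForm.

(** * Involutions from bit strings and padded index sets *)

Section Flip.
Variable n : nat.

(** Both [x] and [rev_ord x] read the bit at the smaller of the two, so they are fixed or exchanged
    together. *)
Definition flip (b : bitseq) (x : 'I_n) : 'I_n :=
  if nth false b (minn x (rev_ord x)) then x else rev_ord x.

Lemma flipK b : involutive (flip b).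
Proof.
move=> x; rewrite {2}/flip; case: ifP => bx; rewrite /flip.
  by rewrite bx.
by rewrite rev_ordK minnC bx.
Qed.

Definition flip_perm b : 'S_n := perm (inv_inj (flipK b)).

(** The hypothesis says [x < rev_ord x]: the bit consulted is that of [x] itself, and an exchange
    really moves [x]. *)
Lemma flip_perm_fix b (x : 'I_n) :
  (x.*2.+1 < n)%N -> (flip_perm b x == x) = nth false b x.
Proof.
move=> xn; rewrite permE /flip.
have -> : minn x (rev_ord x) = x by rewrite /=; lia.
case: ifP => _; first by rewrite eqxx.
by apply/negbTE; rewrite -val_eqE /=; lia.
Qed.

(* The seven positions k, ..., k + 6 only serve to reach m >= 7: a bit string
   b of size k is false there. *)
Definition pad_set (k : nat) (a : bitseq) : {set 'I_n} :=
  [set x : 'I_n | (x < k + 7)%N && ((k <= x)%N || nth false a x)].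

Variable k : nat.
Hypothesis kn : ((k + 7).*2 <= n)%N.

Lemma card_pad_set a : (7 <= #|pad_set k a|)%N.
Proof.
have lt_n (t : 'I_7) : (k + t < n)%N by have := ltn_ord t; lia.
pose h (t : 'I_7) := Ordinal (lt_n t).
have h_inj : injective h.
  by move=> t u /(congr1 val)/= /addnI e; apply: val_inj.
rewrite -[7%N]card_ord -(card_imset _ h_inj) subset_leq_card //.
by apply/fintype.subsetP => _ /imsetP[t _ ->]; rewrite inE /= leq_addr andbT ltn_add2l.
Qed.

(** By [kn] all positions below [k + 7] lie in the lower half, where [flip_perm_fix] applies. *)
Lemma flip_agree a b :
  (\sum_(r < #|pad_set k a|) (flip_perm b (enum_val r) == enum_val r)
   = \sum_(x in pad_set k a) nth false b x)%N.
Proof.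
rewrite -(big_enum_val (fun x => (flip_perm b x == x) : nat)).
apply: eq_bigr => x; rewrite inE => /andP[xk _].
by rewrite flip_perm_fix //; lia.
Qed.

Lemma flip_agree_overlap a b : size b = k ->
  (\sum_(r < #|pad_set k a|) (flip_perm b (enum_val r) == enum_val r)
   = overlap k a b)%N.
Proof.
move=> sb; rewrite flip_agree /overlap.
have lekn : (k <= n)%N by lia.
rewrite (big_ord_widen _ (fun x => (nth false a x && nth false b x) : nat) lekn).
rewrite big_mkcond [RHS]big_mkcond; apply: eq_bigr => x _; rewrite inE.
case: (ltnP x k) => xk /=.
  by rewrite (leq_trans xk (leq_addr _ _)) /=; case: (nth false a x).
by rewrite nth_default ?sb //; case: ifP.
Qed.

(** The only set bit is at the dummy position [k], which belongs to every padded set. This one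
    permutation thus makes all the inequalities tight, and shows that their faces are nonempty. *)
Lemma flip_agree_pad a :
  (\sum_(r < #|pad_set k a|)
     (flip_perm (rcons (nseq k false) true) (enum_val r) == enum_val r) = 1)%N.
Proof.
have ltkn : (k < n)%N by lia.
rewrite flip_agree (bigD1 (Ordinal ltkn)) /=; last first.
  by rewrite inE /= leqnn -[X in (X < _)%N]addn0 ltn_add2l.
rewrite nth_rcons size_nseq ltnn eqxx big1 // => x /andP[_].
rewrite -val_eqE /= => xk.
by rewrite nth_rcons size_nseq nth_nseq (negbTE xk) !if_same.
Qed.

End Flip.

(** * The exponential lower bound *)

Lemma qap_relaxation_extension_bound (R : realType) (n k t : nat)
    (Rn : set 'M[R]_(n * n)) :
  ((k + 7).*2 <= n)%N ->
  QAP R n `<=` Rn ->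
  (forall (m : nat) (i j : 'I_m -> 'I_n),
     (7 <= m)%N -> injective i -> injective j ->
     forall Y : 'M[R]_(n * n), Rn Y -> qap_ineq i j Y) ->
  has_extension_of_size Rn t -> (3 ^ k <= t * 2 ^ k)%N.
Proof.
move=> kn QAPR validR [r [Q [[[s defQ] RnE] nQ]]].
have [phi phiP] := facets_enum nQ.
have lift b : exists y, Q (perm_mx2 R (flip_perm n b), y).
  have : Rn (perm_mx2 R (flip_perm n b)).
    apply: QAPR; exists 1%N, (fun=> perm_mx2 R (flip_perm n b)), (fun=> 1).
    by split; rewrite ?big_ord1 ?scale1r // => _; exists (flip_perm n b).
  by rewrite RnE.
have [y Qy] := choice lift.
pose q b : 'M[R]_(n * n) * 'rV[R]_r := (perm_mx2 R (flip_perm n b), y b).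
pose i a : 'I_#|pad_set n k a| -> 'I_n := enum_val.
pose g a (x : ('M[R]_(n * n) * 'rV[R]_r)%type) : R := qap_form (i a) (i a) x.1.
have gE a : exists f : {scalar ('M[R]_(n * n) * 'rV[R]_r)%type}, f =1 g a.
  by apply: scalar_exists => c u v; apply: qap_form_scalar.
have [f fE] := choice gE.
have f_valid a : valid_ineq Q (f a) 1.
  move=> [Y z] QY; rewrite fE; apply: validR; rewrite ?card_pad_set //.
  - exact: enum_val_inj.
  - exact: enum_val_inj.
  - by rewrite RnE; exists z.
pose G a := [set x | Q x /\ f a x = 1].
apply: (@rectangle_cover_bound k t (fun c a => `[< G a `<=` phi c >])
   (fun c b => `[< ~ phi c (q b) >])).
  move=> a b sa sb ab.
  have [||||F [facF GF Fq]] := @facet_avoiding _ _ s (f a) 1 (q b).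
  - by rewrite -defQ.
  - exists (q (rcons (nseq k false) true)); split.
      by rewrite -defQ; apply: Qy.
    by rewrite fE; apply: qap_form_agree1; apply: flip_agree_pad.
  - by rewrite -defQ; apply: Qy.
  - rewrite fE /g qap_form_agree0; first by move/esym/eqP; rewrite oner_eq0.
    by rewrite flip_agree_overlap.
  - rewrite -defQ in facF GF; have [c Fc] := phiP F facF.
    by exists c; rewrite -Fc; apply/andP; split; apply/asboolP.
(* A pair meeting once has slack 0, so [q b] would lie in [G a] and hence in [phi c]. *)
move=> c a b sa sb /asboolP Gc /asboolP nc ab; apply/nc/Gc.
split; first exact: Qy.
by rewrite fE; apply: qap_form_agree1; rewrite flip_agree_overlap.
Qed.

Theorem theorem10 (R : realType) :
  exists2 c : R, 0 < c & exists N : nat,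
    forall (n : nat) (Rn : set 'M[R]_(n * n)),
      (7 <= n)%N -> (N <= n)%N ->
      polytope Rn ->
      QAP R n `<=` Rn ->
      (forall (m : nat) (i j : 'I_m -> 'I_n),
          (7 <= m)%N -> injective i -> injective j ->
          forall Y : 'M[R]_(n * n), Rn Y -> qap_ineq i j Y) ->
      2 `^ (c * n%:R) <= (xc Rn)%:R.
Proof.
(* The strings have length [2 l], with [l] the largest value for which [2 l + 7] positions fit in
   half of [[n]]; [n >= 40] is ample for [n <= 8 l], whence the exponent [n / 8]. *)
exists (8%:R^-1); first by rewrite invr_gt0.
exists 40%N => n Rn _ nN polR QAPR validR.
pose l := ((n - 14) %/ 4)%N.
have kn : ((l.*2 + 7).*2 <= n)%N by rewrite /l; lia.
have n8 : (n <= 8 * l)%N by rewrite /l; lia.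
have bound := qap_relaxation_extension_bound kn QAPR validR (xcP polR).
have le_xc : (2 ^ l <= xc Rn)%N.
  rewrite -(@leq_pmul2r (2 ^ l.*2)) ?expn_gt0 //; apply: leq_trans bound.
  (* [3 ^ (2 l) = 9 ^ l] is at least [8 ^ l = 2 ^ l * 2 ^ (2 l)]. *)
  by rewrite -!mul2n !expnM -expnMn leq_exp2r //; lia.
apply: (@le_trans _ _ (2 `^ l%:R)).
  apply: ler_powR; first by rewrite ler1n.
  by rewrite mulrC ler_pdivrMr // mulrC -natrM ler_nat.
by rewrite powR_mulrn // -natrX ler_nat.
Qed.
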